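(* Let $M^3$ be an orientable smooth 3-manifold with Riemannian metric $g$, and let $U$ be a local chart domain of $M^3$ with coordinates $x^1,x^2,x^3$ such that $\{\partial/\partial x^1,\partial/\partial x^2,\partial/\partial x^3\}$ is positively oriented. Let $\{e_1,e_2,e_3\}$ be a positively oriented $g$-orthonormal frame on $U$, and write $e_\alpha=\sum_{i=1}^3 b_\alpha^i\,\frac{\partial}{\partial x^i}$ with smooth functions $b_\alpha^i$; let $B=(b_\alpha^i)$ be the matrix with row index $\alpha$ and column index $i$. Then $\{e_1,e_2,e_3\}$ is a $\phi$-eigenbasis of a contact metric structure $(g,\eta,\xi,\phi)$ on $U$ if and only if the following five equations hold on $U$ (summation over the repeated index $i=1,2,3$): $$(b_1^2b_2^3-b_1^3b_2^2)\Bigl(b_3^i\tfrac{\partial b_1^1}{\partial x^i}-b_1^i\tfrac{\partial b_3^1}{\partial x^i}\Bigr)+(b_1^3b_2^1-b_1^1b_2^3)\Bigl(b_3^i\tfrac{\partial b_1^2}{\partial x^i}-b_1^i\tfrac{\partial b_3^2}{\partial x^i}\Bigr)+(b_1^1b_2^2-b_1^2b_2^1)\Bigl(b_3^i\tfrac{\partial b_1^3}{\partial x^i}-b_1^i\tfrac{\partial b_3^3}{\partial x^i}\Bigr)=0,$$ $$(b_1^2b_2^3-b_1^3b_2^2)\Bigl(b_3^i\tfrac{\partial b_2^1}{\partial x^i}-b_2^i\tfrac{\partial b_3^1}{\partial x^i}\Bigr)+(b_1^3b_2^1-b_1^1b_2^3)\Bigl(b_3^i\tfrac{\partial b_2^2}{\partial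 x^i}-b_2^i\tfrac{\partial b_3^2}{\partial x^i}\Bigr)+(b_1^1b_2^2-b_1^2b_2^1)\Bigl(b_3^i\tfrac{\partial b_2^3}{\partial x^i}-b_2^i\tfrac{\partial b_3^3}{\partial x^i}\Bigr)=0,$$ $$(b_1^2b_2^3-b_1^3b_2^2)\Bigl(b_1^i\tfrac{\partial b_2^1}{\partial x^i}-b_2^i\tfrac{\partial b_1^1}{\partial x^i}\Bigr)+(b_1^3b_2^1-b_1^1b_2^3)\Bigl(b_1^i\tfrac{\partial b_2^2}{\partial x^i}-b_2^i\tfrac{\partial b_1^2}{\partial x^i}\Bigr)+(b_1^1b_2^2-b_1^2b_2^1)\Bigl(b_1^i\tfrac{\partial b_2^3}{\partial x^i}-b_2^i\tfrac{\partial b_1^3}{\partial x^i}\Bigr)=2\det B,$$ $$(b_2^2b_3^3-b_2^3b_3^2)\Bigl(b_3^i\tfrac{\partial b_1^1}{\partial x^i}-b_1^i\tfrac{\partial b_3^1}{\partial x^i}\Bigr)+(b_2^3b_3^1-b_2^1b_3^3)\Bigl(b_3^i\tfrac{\partial b_1^2}{\partial x^i}-b_1^i\tfrac{\partial b_3^2}{\partial x^i}\Bigr)+(b_2^1b_3^2-b_2^2b_3^1)\Bigl(b_3^i\tfrac{\partial b_1^3}{\partial x^i}-b_1^i\tfrac{\partial b_3^3}{\partial x^i}\Bigr)=0,$$ $$(b_1^3b_3^2-b_1^2b_3^3)\Bigl(b_3^i\tfrac{\partial b_2^1}{\partial x^i}-b_2^i\tfrac{\partial b_3^1}{\partial x^i}\Bigr)+(b_1^1b_3^3-b_1^3b_3^1)\Bigl(b_3^i\tfrac{\partial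 b_2^2}{\partial x^i}-b_2^i\tfrac{\partial b_3^2}{\partial x^i}\Bigr)+(b_1^2b_3^1-b_1^1b_3^2)\Bigl(b_3^i\tfrac{\partial b_2^3}{\partial x^i}-b_2^i\tfrac{\partial b_3^3}{\partial x^i}\Bigr)=0.$$
   Context: A contact metric structure $(g,\eta,\xi,\phi)$ on a 3-manifold consists of a Riemannian metric $g$, a $1$-form $\eta$ with $\eta\wedge d\eta\neq 0$ everywhere, a vector field $\xi$ with $\eta(\xi)=1$ and $d\eta(\xi,\cdot)=0$, and a $(1,1)$-tensor field $\phi$, such that $\phi^2=-I+\eta\otimes\xi$, $\eta(X)=g(X,\xi)$ and $d\eta(X,Y)=g(X,\phi Y)$ for all vector fields $X,Y$, where the convention is $d\eta(X,Y)=\frac12\bigl(X\eta(Y)-Y\eta(X)-\eta([X,Y])\bigr)$. Set $h=\frac12\mathcal{L}_\xi\phi$ ($\mathcal L$ the Lie derivative). An ordered frame $\{e_1,e_2,e_3\}$ is a $\phi$-eigenbasis of the structure if it is orthonormal, $e_3=\xi$, $e_2=\phi e_1$, and $he_1=\lambda e_1$, $he_2=-\lambda e_2$ for some function $\lambda$. *)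

(* Defs.v *)
From HB Require Import structures.
From mathcomp Require Import all_boot all_order all_algebra.
From mathcomp Require Import all_classical all_reals all_analysis.

Set Implicit Arguments.
Unset Strict Implicit.
Unset Printing Implicit Defensive.

Import Order.TTheory GRing.Theory Num.Theory.
Import numFieldNormedType.Exports.

Local Open Scope classical_set_scope.
Local Open Scope ring_scope.

(* Indices are numbered from 1, as on paper. *)
Definition I1 : 'I_3 := @Ordinal 3 0 isT.
Definition I2 : 'I_3 := @Ordinal 3 1 isT.
Definition I3 : 'I_3 := @Ordinal 3 2 isT.

(* [coord] and [inv] are total functions, meaningful only on [dom] and on
   [coord @` dom] respectively. *)
Record chart (R : realType) (M : topologicalType) := Chart {
  dom : set M;
  coord : M -> 'rV[R]_3;
  inv : 'rV[R]_3 -> M;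
  dom_open : open dom;
  img_open : open (coord @` dom);
  coordK : forall p, dom p -> inv (coord p) = p;
  coord_cts : forall p, dom p -> {for p, continuous coord};
  inv_cts : forall p, dom p -> {for coord p, continuous inv}
}.

Section ChartCalculus.
Context {R : realType} {M : topologicalType}.
Variable c : chart R M.
Implicit Types (f : M -> R) (p : M) (A : set M).

(* The partial derivative of f with respect to the i-th coordinate of c. *)
Definition pd (i : 'I_3) f p : R :=
  'D_(delta_mx 0 i) (f \o inv c) (coord c p).

Definition pds (s : seq 'I_3) f : M -> R := foldr pd f s.

(* C^oo on the open set A `<=` dom c: every iterated partial derivative, of
   any order, exists and is continuous at each point of A. *)
Definition smooth A f : Prop :=
  forall (s : seq 'I_3) p, A p ->
    {for p, continuous (pds s f)} /\
    forall i, derivable (pds s f \o inv c) (coord c p) (delta_mx 0 i).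

End ChartCalculus.

(* Row i holds the components of d/dx^i of c in the coordinate frame of c'. *)
Definition jac (R : realType) (M : topologicalType) (c c' : chart R M)
    (p : M) : 'M[R]_3 :=
  \matrix_(i, j) pd c i (fun q => coord c' q 0 j) p.

Definition smooth_transition (R : realType) (M : topologicalType)
    (c c' : chart R M) : Prop :=
  forall j, smooth c (dom c `&` dom c') (fun q => coord c' q 0 j).

Definition oriented_compatible (R : realType) (M : topologicalType)
    (c c' : chart R M) : Prop :=
  [/\ smooth_transition c c', smooth_transition c' c &
      forall p, dom c p -> dom c' p -> 0 < \det (jac c c' p)].

(* An orientable smooth 3-manifold with a chosen orientation, given by its
   maximal oriented atlas: [atlas] consists of all the coordinate systems
   whose coordinate frame is positively oriented. *)
Record oriented_manifold3 (R : realType) := OrientedManifold3 {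
  carrier :> topologicalType;
  carrier_hausdorff : hausdorff_space carrier;
  carrier_second_countable : @second_countable carrier;
  atlas : set (chart R carrier);
  atlas_cover : forall p, exists2 c, atlas c & dom c p;
  atlas_compatible :
    forall c c', atlas c -> atlas c' -> oriented_compatible c c';
  atlas_maximal :
    forall c, (forall c', atlas c' -> oriented_compatible c c') -> atlas c
}.

(* [gmat c] is the matrix of the metric in the coordinate frame of c. *)
Record riemannian_metric (R : realType) (M : oriented_manifold3 R) :=
    RiemannianMetric {
  gmat : chart R M -> M -> 'M[R]_3;
  gmat_smooth : forall c, atlas c -> forall i j,
    smooth c (dom c) (fun p => gmat c p i j);
  gmat_sym : forall c, atlas c -> forall p, dom c p ->
    (gmat c p)^T = gmat c p;
  gmat_pos : forall c, atlas c -> forall p, dom c p ->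
    forall v : 'rV[R]_3, v != 0 -> 0 < (v *m gmat c p *m v^T) 0 0;
  gmat_change : forall c c', atlas c -> atlas c' ->
    forall p, dom c p -> dom c' p ->
    gmat c p = jac c c' p *m gmat c' p *m (jac c c' p)^T
}.

(* Tensor fields on the domain U of a chart c are given by their components in
   the coordinate frame: a vector field X or a 1-form eta is a row-valued
   function, and a (1,1)-tensor field phi is a matrix-valued function whose
   row i holds the components of phi(d/dx^i), so that it acts on the row of
   components of a vector by multiplication on the right. *)
Section Tensors.
Context {R : realType} {M : oriented_manifold3 R}.
Variable c : chart R M.
Implicit Types (X Y Z xi eta : M -> 'rV[R]_3) (phi : M -> 'M[R]_3).
Implicit Types (f : M -> R) (p : M) (g : riemannian_metric M).

Definition smooth_row X : Prop :=
  forall i, smooth c (dom c) (fun p => X p 0 i).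

Definition smooth_endo phi : Prop :=
  forall i j, smooth c (dom c) (fun p => phi p i j).

Definition inner g X Y p : R := (X p *m gmat g c p *m (Y p)^T) 0 0.

Definition pair_form eta X p : R := \sum_i eta p 0 i * X p 0 i.

Definition app_endo phi X p : 'rV[R]_3 := X p *m phi p.

Definition dir X f p : R := \sum_i X p 0 i * pd c i f p.

Definition bracket X Y p : 'rV[R]_3 :=
  \row_j (dir X (fun q => Y q 0 j) p - dir Y (fun q => X q 0 j) p).

(* The convention for exterior derivatives is the one with factor 1/2. *)
Definition dform eta X Y p : R :=
  2^-1 * (dir X (pair_form eta Y) p - dir Y (pair_form eta X) p
          - pair_form eta (bracket X Y) p).

(* The 3-form eta /\ d(eta), normalized consistently with [dform]. *)
Definition wedge_d eta X Y Z p : R :=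
  3^-1 * (pair_form eta X p * dform eta Y Z p
        + pair_form eta Y p * dform eta Z X p
        + pair_form eta Z p * dform eta X Y p).

(* (L_xi phi) X = [xi, phi X] - phi [xi, X] *)
Definition lie_endo xi phi X p : 'rV[R]_3 :=
  bracket xi (app_endo phi X) p - app_endo phi (bracket xi X) p.

Definition h_field xi phi X p : 'rV[R]_3 := 2^-1 *: lie_endo xi phi X p.

Record contact_metric g eta xi phi : Prop := ContactMetric {
  eta_smooth : smooth_row eta;
  xi_smooth : smooth_row xi;
  phi_smooth : smooth_endo phi;
  eta_contact : forall p, dom c p -> exists X Y Z,
    [/\ smooth_row X, smooth_row Y, smooth_row Z & wedge_d eta X Y Z p != 0];
  eta_xi : forall p, dom c p -> pair_form eta xi p = 1;
  deta_xi : forall X, smooth_row X -> forall p, dom c p ->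
    dform eta xi X p = 0;
  phi_sqr : forall X, smooth_row X -> forall p, dom c p ->
    app_endo phi (app_endo phi X) p = - X p + pair_form eta X p *: xi p;
  eta_dual : forall X, smooth_row X -> forall p, dom c p ->
    pair_form eta X p = inner g X xi p;
  deta_metric : forall X Y, smooth_row X -> smooth_row Y ->
    forall p, dom c p -> dform eta X Y p = inner g X (app_endo phi Y) p
}.

Definition orthonormal_frame g (e : 'I_3 -> M -> 'rV[R]_3) : Prop :=
  forall a b p, dom c p -> inner g (e a) (e b) p = (a == b)%:R.

Definition phi_eigenbasis g xi phi (e : 'I_3 -> M -> 'rV[R]_3) : Prop :=
  [/\ orthonormal_frame g e,
      forall p, dom c p -> e I3 p = xi p,
      forall p, dom c p -> e I2 p = app_endo phi (e I1) p &
      exists lambda : M -> R, forall p, dom c p ->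
        h_field xi phi (e I1) p = lambda p *: e I1 p /\
        h_field xi phi (e I2) p = - lambda p *: e I2 p].

(* e_a = sum_i b_a^i d/dx^i *)
Definition frame (b : 'I_3 -> 'I_3 -> M -> R) (a : 'I_3) p : 'rV[R]_3 :=
  \row_i b a i p.

End Tensors.

(* Main.v *)
(* Write D for the determinant of the frame and [C_ab^k] for the coefficient of
   e_k in [e_a, e_b]; each equation of the theorem prescribes one of them times
   D, through a triple product.  Since eta(e_a) is constant,
   d(eta)(e_a, e_b) = - eta([e_a, e_b]) / 2, so the contact metric conditions
   amount to C_31^3 = C_32^3 = 0 and C_12^3 = 2, which are the first three
   equations.  Given these, h e_1 and h e_2 have the required form if and only
   if C_31^1 = C_32^2.  Finally d(d(eta)) = 0, which says that the vector field
   e_3 / D is divergence-free in the coordinates, reads C_31^1 + C_32^2 = 0; so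
   both numbers vanish, which is the last two equations. *)
Require Import Defs.
From mathcomp Require Import all_boot all_order all_algebra.
From mathcomp Require Import all_classical all_reals all_analysis.
From mathcomp Require Import ring.
Import Order.TTheory GRing.Theory Num.Theory.
Import numFieldNormedType.Exports.
(* [coord] from [vector] would otherwise hide the one of the charts. *)
Import Defs.
Local Open Scope classical_set_scope.
Local Open Scope ring_scope.

Set Implicit Arguments.
Unset Strict Implicit.
Unset Printing Implicit Defensive.

(** * Symmetry of second derivatives *)

Lemma derive_translate (R : numFieldType) (V W : normedModType R)
    (f : V -> W) (a x v : V) :
  'D_v (fun z => f (z + a)) x = 'D_v f (x + a).
Proof.
rewrite /derive.
suff -> : (fun h : R => h^-1 *:
    (((fun z => f (z + a)) \o shift x) (h *: v) - f (x + a))) =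
  (fun h => h^-1 *: ((f \o shift (x + a)) (h *: v) - f (x + a))) by [].
by apply/funext => h /=; rewrite addrA.
Qed.

Lemma derivable_translate (R : numFieldType) (V W : normedModType R)
    (f : V -> W) (a x v : V) :
  derivable (fun z => f (z + a)) x v <-> derivable f (x + a) v.
Proof.
rewrite /derivable.
suff -> : (fun h : R => h^-1 *:
    (((fun z => f (z + a)) \o shift x) (h *: v) - f (x + a))) =
  (fun h => h^-1 *: ((f \o shift (x + a)) (h *: v) - f (x + a))) by [].
by apply/funext => h /=; rewrite addrA.
Qed.

Lemma is_derive_line (R : numFieldType) (V W : normedModType R)
    (f : V -> W) (x v : V) (s : R) :
  derivable f (x + s *: v) v ->
  is_derive s 1 (fun r : R => f (x + r *: v)) ('D_v f (x + s *: v)).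
Proof.
have E : (fun h : R => h^-1 *: (((fun r : R => f (x + r *: v)) \o shift s)
      (h *: 1) - f (x + s *: v))) =
    (fun h => h^-1 *: ((f \o shift (x + s *: v)) (h *: v) - f (x + s *: v))).
  apply/funext => h /=; congr (_ *: (f _ - _)).
  by rewrite [h *: 1]mulr1 scalerDl addrCA.
by move=> df; split; [rewrite /derivable E|rewrite /derive E].
Qed.

Lemma MVT_line (R : realType) (V : normedModType R) (f : V -> R) (x v : V)
    (t : R) :
  0 <= t -> (forall s, 0 <= s <= t -> derivable f (x + s *: v) v) ->
  exists2 s, 0 <= s <= t &
    f (x + t *: v) - f x = t * 'D_v f (x + s *: v).
Proof.
move=> t0 df.
have dl s : s \in `[0, t] -> is_derive s 1 (fun r : R => f (x + r *: v))
    ('D_v f (x + s *: v)).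
  by rewrite in_itv /= => st; apply: is_derive_line; exact: df.
have cl : {within `[0, t], continuous (fun r : R => f (x + r *: v))}.
  by apply: derivable_within_continuous => s /dl [].
have [s] := MVT_segment t0 (fun s st => dl s (subset_itv_oo_cc st)) cl.
rewrite in_itv /= => st E; exists s => //.
by move: E; rewrite scale0r addr0 subr0 mulrC.
Qed.

(** The mean value theorem is applied twice: to [z |-> f (z + t w) - f z] along [v], then to
    ['D_v f] along [w]. *)
Lemma second_difference (R : realType) (V : normedModType R) (f : V -> R)
    (x v w : V) (t : R) :
  0 <= t ->
  (forall s r, 0 <= s <= t -> 0 <= r <= t ->
    derivable f (x + s *: v + r *: w) v /\
    derivable ('D_v f) (x + s *: v + r *: w) w) ->
  exists s r, [/\ 0 <= s <= t, 0 <= r <= t &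
    f (x + t *: v + t *: w) - f (x + t *: v) - (f (x + t *: w) - f x) =
    t * (t * 'D_w ('D_v f) (x + s *: v + r *: w))].
Proof.
move=> t0 df.
have t0t : 0 <= (0 : R) <= t by rewrite (@lexx _ R).
have tt : 0 <= t <= t by rewrite t0 (@lexx _ R).
have d1 s : 0 <= s <= t -> derivable (fun z => f (z + t *: w)) (x + s *: v) v.
  by move=> st; apply/derivable_translate; case: (df _ _ st tt).
have d2 s : 0 <= s <= t -> derivable f (x + s *: v) v.
  by move=> st; case: (df _ _ st t0t); rewrite scale0r addr0.
have [s st E1] := @MVT_line R V ((fun z => f (z + t *: w)) - f) x v t t0
  (fun s st => derivableB (d1 s st) (d2 s st)).
have [r rt E2] := @MVT_line R V ('D_v f) (x + s *: v) w t t0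
  (fun r rt => (df s r st rt).2).
exists s, r; split=> //; rewrite -E2.
by move: E1; rewrite deriveB ?derive_translate //; [exact: d1|exact: d2].
Qed.

(** Schwarz's theorem. The second difference over a small parallelogram is symmetric in [v] and [w],
    so a value of one mixed derivative near [x] equals a value of the other near [x]; continuity
    brings both points back to [x] up to any [e]. *)
Lemma derive_comm (R : realType) (V : normedModType R) (f : V -> R)
    (x v w : V) :
  (\forall z \near x,
    [/\ derivable f z v, derivable f z w,
        derivable ('D_v f) z w & derivable ('D_w f) z v]) ->
  {for x, continuous ('D_w ('D_v f))} ->
  {for x, continuous ('D_v ('D_w f))} ->
  'D_w ('D_v f) x = 'D_v ('D_w f) x.
Proof.
move=> df cvw cwv; apply/eqP; rewrite -subr_eq0 -normr_le0.
apply/ler_addgt0Pr => e e0; rewrite add0r.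
have e20 : 0 < e / 2 by rewrite divr_gt0.
have nv : \forall z \near x, `|'D_w ('D_v f) x - 'D_w ('D_v f) z| < e / 2.
  by have /cvgrPdist_lt := cvw; apply.
have nw : \forall z \near x, `|'D_v ('D_w f) x - 'D_v ('D_w f) z| < e / 2.
  by have /cvgrPdist_lt := cwv; apply.
pose P z := [/\ derivable f z v, derivable f z w,
    derivable ('D_v f) z w & derivable ('D_w f) z v] /\
  (`|'D_w ('D_v f) x - 'D_w ('D_v f) z| < e / 2 /\
   `|'D_v ('D_w f) x - 'D_v ('D_w f) z| < e / 2).
have nP : \forall z \near x, P z by exact: filterI df (filterI nv nw).
have /nbhs_normP [d /= d0 dP] := nP.
(* Small enough for the parallelogram with sides [t v] and [t w] to stay in the ball; the [+ 1]
   keeps the denominator positive and the estimate strict. *)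
pose t := d / (`|v| + `|w| + 1).
have N0 : 0 < `|v| + `|w| + 1 by rewrite ltr_wpDl // addr_ge0.
have t0 : 0 < t by rewrite divr_gt0.
have Pt s r : 0 <= s <= t -> 0 <= r <= t -> P (x + s *: v + r *: w).
  move=> /andP[s0 st] /andP[r0 rt]; apply: dP => /=.
  rewrite /ball_ /= -addrA opprD addNKr normrN.
  apply: (le_lt_trans (ler_normD _ _)); rewrite !normrZ !ger0_norm //.
  apply: (@le_lt_trans _ _ (t * `|v| + t * `|w|)).
    by apply: lerD; apply: ler_wpM2r.
  by rewrite -mulrDr /t mulrAC ltr_pdivrMr // ltr_pM2l // ltrDl.
have [s [r [st rt E1]]] : exists s r, [/\ 0 <= s <= t, 0 <= r <= t &
    f (x + t *: v + t *: w) - f (x + t *: v) - (f (x + t *: w) - f x) =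
    t * (t * 'D_w ('D_v f) (x + s *: v + r *: w))].
  apply: second_difference; first exact: ltW.
  by move=> s r st rt; have [[]] := Pt s r st rt.
have AC a a' : x + a + a' = x + a' + a := addrAC x a a'.
have [r' [s' [rt' st' E2]]] : exists r s, [/\ 0 <= r <= t, 0 <= s <= t &
    f (x + t *: w + t *: v) - f (x + t *: w) - (f (x + t *: v) - f x) =
    t * (t * 'D_v ('D_w f) (x + r *: w + s *: v))].
  apply: second_difference; first exact: ltW.
  by move=> r' s' rt' st'; have := Pt s' r' st' rt'; rewrite AC => -[[]].
(* Both sides times [t ^ 2] are the same second difference. *)
have E : 'D_w ('D_v f) (x + s *: v + r *: w) =
         'D_v ('D_w f) (x + r' *: w + s' *: v).
  apply: (mulfI (lt0r_neq0 t0)); apply: (mulfI (lt0r_neq0 t0)).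
  refine (etrans (esym E1) (etrans _ E2)); rewrite (AC (t *: w) (t *: v)).
  move: (f _) (f (x + t *: v)) (f (x + t *: w)) (f x) => F B C A; ring.
have [_ [H1 _]] := Pt _ _ st rt.
have := Pt _ _ st' rt'; rewrite AC => -[_ [_ H2]].
rewrite E in H1.
rewrite distrC in H2; rewrite (splitr e).
exact: (le_trans (ler_distD _ _ _) (ltW (ltrD H1 H2))).
Qed.

(** * Smooth functions on a chart *)

Section ChartSmoothness.
Context {R : realType} {M : topologicalType} (c : chart R M).
Implicit Types (f g : M -> R) (p : M) (i j : 'I_3).

(** Since the image of the chart is open, a derivative at [coord c p] only sees values on [dom c],
    where the total functions are meaningful. *)
Lemma near_coord_inv p : dom c p ->
  \forall x \near coord c p, dom c (inv c x) /\ coord c (inv c x) = x.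
Proof.
move=> cp; have : nbhs (coord c p) (coord c @` dom c).
  by apply: open_nbhs_nbhs; split; [exact: img_open|exists p].
by apply: filterS => _ [q cq <-]; rewrite coordK.
Qed.

Lemma near_dom p : dom c p -> \forall q \near p, dom c q.
Proof. by move=> cp; apply: open_nbhs_nbhs; split; [exact: dom_open|]. Qed.

Lemma near_eq_inv f g p : (forall q, dom c q -> f q = g q) -> dom c p ->
  {near coord c p, f \o inv c =1 g \o inv c}.
Proof.
by move=> fg /near_coord_inv; apply: filterS => x [cx _]; exact: fg.
Qed.

Lemma pd_congr i f g p : (forall q, dom c q -> f q = g q) -> dom c p ->
  pd c i f p = pd c i g p.
Proof. by move=> fg cp; apply: near_eq_derive; exact: near_eq_inv. Qed.

(** The condition that [smooth] puts on each single iterated derivative, isolated so that smoothness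
    can be proved by closure under [pd]. *)
Definition regular f := forall p, dom c p ->
  {for p, continuous f} /\
  forall i, derivable (f \o inv c) (coord c p) (delta_mx 0 i).

Lemma regular_congr f g :
  (forall q, dom c q -> f q = g q) -> regular f -> regular g.
Proof.
move=> fg fr p cp; have [fc fd] := fr p cp; split=> [|i].
  have nfg : {near p, f =1 g}.
    by move: (near_dom cp); apply: filterS => q; exact: fg.
  rewrite /prop_for /continuous_at -(fg _ cp).
  exact: cvg_trans (near_eq_cvg nfg) fc.
by apply: near_eq_derivable (fd i); exact: near_eq_inv.
Qed.

Lemma smooth_regular f : smooth c (dom c) f -> regular f.
Proof. by move=> fs; exact: (fs [::]). Qed.

(** Coinduction: iterated derivatives never leave [S], so regularity of its members settles all
    orders at once. *)
Lemma smooth_coind (S : set (M -> R)) :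
  (forall f, S f -> regular f) -> (forall f i, S f -> S (pd c i f)) ->
  forall f, S f -> smooth c (dom c) f.
Proof.
move=> Sreg Spd f Sf s p; apply: Sreg.
by elim: s => //= i s; exact: Spd.
Qed.

Lemma smooth_pd i f : smooth c (dom c) f -> smooth c (dom c) (pd c i f).
Proof. by move=> fs s; have := fs (rcons s i); rewrite /pds foldr_rcons. Qed.

Lemma regularD f g : regular f -> regular g -> regular (fun q => f q + g q).
Proof.
move=> fr gr p cp; have [fc fd] := fr p cp; have [gc gd] := gr p cp.
by split=> [|i]; [exact: cvgD fc gc|exact: derivableD (fd i) (gd i)].
Qed.

Lemma regularM f g : regular f -> regular g -> regular (fun q => f q * g q).
Proof.
move=> fr gr p cp; have [fc fd] := fr p cp; have [gc gd] := gr p cp.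
by split=> [|i]; [exact: cvgM fc gc|exact: derivableM (fd i) (gd i)].
Qed.

Lemma pdD i f g p : regular f -> regular g -> dom c p ->
  pd c i (fun q => f q + g q) p = pd c i f p + pd c i g p.
Proof.
move=> fr gr cp; have [_ fd] := fr p cp; have [_ gd] := gr p cp.
exact: deriveD (fd i) (gd i).
Qed.

Lemma pdM i f g p : regular f -> regular g -> dom c p ->
  pd c i (fun q => f q * g q) p = f p * pd c i g p + g p * pd c i f p.
Proof.
move=> fr gr cp; have [_ fd] := fr p cp; have [_ gd] := gr p cp.
by have := deriveM (fd i) (gd i); rewrite /= !coordK.
Qed.

Lemma pd_cst i (k : R) : pd c i (cst k) = cst 0.
Proof. by apply/funext => p; exact: derive_cst. Qed.

Lemma smooth_cst (k : R) : smooth c (dom c) (cst k).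
Proof.
apply: (@smooth_coind (range (@cst M R))); last by exists k.
  move=> _ [l _ <-] p cp; split=> [|i]; first exact: cvg_cst.
  exact: derivable_cst.
by move=> _ i [l _ <-]; rewrite pd_cst; exists 0.
Qed.

(* Closed under [pd] by the Leibniz rule, hence made of smooth functions. *)
Inductive smooth_span : (M -> R) -> Prop :=
| span_smooth f of smooth c (dom c) f : smooth_span f
| spanD f g of smooth_span f & smooth_span g :
    smooth_span (fun q => f q + g q)
| spanM f g of smooth_span f & smooth_span g :
    smooth_span (fun q => f q * g q)
| span_congr f g of (forall q, dom c q -> f q = g q) & smooth_span f :
    smooth_span g.

Lemma smooth_span_smooth f : smooth_span f -> smooth c (dom c) f.
Proof.
have Sreg g : smooth_span g -> regular g.
  elim=> [{}g|{}g h _ gr _ hr|{}g h _ gr _ hr|{}g h gh _].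
  - exact: smooth_regular.
  - exact: regularD.
  - exact: regularM.
  - exact: regular_congr.
apply: (@smooth_coind smooth_span) f => // f i.
elim=> [{}f fs|{}f g fs fS gs gS|{}f g fs fS gs gS|{}f g fg _ fS].
- by apply: span_smooth; exact: smooth_pd.
(* The rules for [pd] hold only on [dom c], whence the closure of the span under agreement there. *)
- apply: span_congr (spanD fS gS) => q cq.
  by rewrite pdD //; exact: Sreg.
- apply: span_congr (spanD (spanM fs gS) (spanM gs fS)) => q cq.
  by rewrite pdM //; exact: Sreg.
- by apply: span_congr fS => q cq; exact: pd_congr.
Qed.

Lemma smooth_congr f g : (forall q, dom c q -> f q = g q) ->
  smooth c (dom c) f -> smooth c (dom c) g.
Proof.
move=> fg fs; apply: smooth_span_smooth.
by apply: span_congr fg _; exact: span_smooth.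
Qed.

Lemma smoothD f g : smooth c (dom c) f -> smooth c (dom c) g ->
  smooth c (dom c) (fun q => f q + g q).
Proof.
by move=> fs gs; apply: smooth_span_smooth; apply: spanD; exact: span_smooth.
Qed.

Lemma smoothM f g : smooth c (dom c) f -> smooth c (dom c) g ->
  smooth c (dom c) (fun q => f q * g q).
Proof.
by move=> fs gs; apply: smooth_span_smooth; apply: spanM; exact: span_smooth.
Qed.

Lemma smooth_sum n (F : 'I_n -> M -> R) :
  (forall k, smooth c (dom c) (F k)) ->
  smooth c (dom c) (fun q => \sum_k F k q).
Proof.
move=> Fs; elim: (index_enum 'I_n) => [|k r IH].
  by apply: smooth_congr (smooth_cst 0) => q _; rewrite big_nil.
by apply: smooth_congr (smoothD (Fs k) IH) => q _; rewrite big_cons.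
Qed.

Lemma pd_sum n (F : 'I_n -> M -> R) i p :
  (forall k, smooth c (dom c) (F k)) -> dom c p ->
  pd c i (fun q => \sum_k F k q) p = \sum_k pd c i (F k) p.
Proof.
move=> Fs cp.
(* Smoothness of the partial sums is carried along, as [pdD] asks for regular summands. *)
suff [] : smooth c (dom c) (fun q => \sum_k F k q) /\
    pd c i (fun q => \sum_k F k q) p = \sum_k pd c i (F k) p by [].
elim: (index_enum 'I_n) => [|k r [IHs IH]].
  rewrite big_nil (_ : (fun q => _) = cst 0) ?pd_cst //.
    by split=> //; exact: smooth_cst.
  by apply/funext => q; rewrite big_nil.
rewrite big_cons -IH (_ : (fun q => _) =
  fun q => F k q + \sum_(l <- r) F l q).
  split; first exact: smoothD.
  by rewrite pdD //; exact: smooth_regular.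
by apply/funext => q; rewrite big_cons.
Qed.

(** [derive_comm] read in the chart. [pd c k g \o inv c] is a directional derivative of [g \o inv c]
    only near image points, so derivability and continuity are transported along local
    equalities. *)
Lemma pd_comm i j f p : smooth c (dom c) f -> dom c p ->
  pd c i (pd c j f) p = pd c j (pd c i f) p.
Proof.
move=> fs cp.
have pdE k g q : dom c q ->
    {near coord c q, pd c k g \o inv c =1 'D_(delta_mx 0 k) (g \o inv c)}.
  by move/near_coord_inv; apply: filterS => x [_ xE]; rewrite /= /pd xE.
have pd2E k l q : dom c q -> pd c k (pd c l f) q =
    'D_(delta_mx 0 k) ('D_(delta_mx 0 l) (f \o inv c)) (coord c q).
  by move=> cq; apply: near_eq_derive; exact: pdE.
have cts k l : {for coord c p, continuous
    ('D_(delta_mx 0 k) ('D_(delta_mx 0 l) (f \o inv c)))}.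
  have [pdc _] := smooth_regular (smooth_pd k (smooth_pd l fs)) cp.
  rewrite /prop_for /continuous_at -pd2E //.
  have ic : pd c k (pd c l f) \o inv c @ coord c p --> pd c k (pd c l f) p.
    rewrite -[X in _ --> pd c k _ X](coordK cp).
    by apply: continuous_comp; rewrite ?coordK //; exact: inv_cts.
  have nE : {near coord c p, pd c k (pd c l f) \o inv c =1
      'D_(delta_mx 0 k) ('D_(delta_mx 0 l) (f \o inv c))}.
    move: (near_coord_inv cp); apply: filterS => x [cx xE].
    by have := pd2E k l _ cx; rewrite xE.
  exact: cvg_trans (near_eq_cvg nE) ic.
rewrite (pd2E i j _ cp) (pd2E j i _ cp).
apply: (@derive_comm _ _ _ _ _ _ _ (cts i j) (cts j i)).
move: (near_coord_inv cp); apply: filterS => x [cx xE]; rewrite -xE.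
have [_ fd] := smooth_regular fs cx.
have fd2 k l : derivable ('D_(delta_mx 0 k) (f \o inv c))
    (coord c (inv c x)) (delta_mx 0 l).
  have [_ /(_ l)] := smooth_regular (smooth_pd k fs) cx.
  by apply: near_eq_derivable; exact: pdE.
by split; [exact: fd|exact: fd|exact: fd2|exact: fd2].
Qed.

Lemma smoothB f g : smooth c (dom c) f -> smooth c (dom c) g ->
  smooth c (dom c) (fun q => f q - g q).
Proof.
move=> fs gs.
refine (smooth_congr _ (smoothD fs (smoothM (smooth_cst (-1)) gs))) => q _.
by rewrite mulN1r.
Qed.

Lemma pdZ i (k : R) f p : smooth c (dom c) f -> dom c p ->
  pd c i (fun q => k * f q) p = k * pd c i f p.
Proof.
move=> fs cp; have ks := smooth_regular (smooth_cst k).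
have -> := pdM i ks (smooth_regular fs) cp.
by rewrite pd_cst mulr0 addr0.
Qed.

Lemma pdB i f g p : smooth c (dom c) f -> smooth c (dom c) g -> dom c p ->
  pd c i (fun q => f q - g q) p = pd c i f p - pd c i g p.
Proof.
move=> fs gs cp; have ms := smoothM (smooth_cst (-1)) gs.
rewrite -[- pd c i g p]mulN1r -(pdZ i (-1) gs cp).
rewrite -(pdD i (smooth_regular fs) (smooth_regular ms) cp).
by congr (pd c i _ p); apply/funext => q; rewrite mulN1r.
Qed.

Lemma pdN i f p : smooth c (dom c) f -> dom c p ->
  pd c i (fun q => - f q) p = - pd c i f p.
Proof.
move=> fs cp; rewrite -mulN1r -(pdZ i (-1) fs cp).
by congr (pd c i _ p); apply/funext => q; rewrite mulN1r.
Qed.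

End ChartSmoothness.

(** * Triple products and exterior derivatives *)

Local Opaque pd smooth.

Lemma sum3 (V : nmodType) (F : 'I_3 -> V) :
  \sum_i F i = F I1 + F I2 + F I3.
Proof.
rewrite !big_ord_recl big_ord0 addr0 addrA.
by congr (F _ + F _ + F _); apply: val_inj.
Qed.

Lemma ord3P (i : 'I_3) : [\/ i = I1, i = I2 | i = I3].
Proof.
by case: i => [[|[|[|//]]] ?]; [apply: Or31|apply: Or32|apply: Or33];
  apply: val_inj.
Qed.

Section TripleProduct.
Context {F : fieldType}.
Implicit Types (u v w x y s : 'rV[F]_3).

(** The determinant with rows [u], [v], [w], expanded along the last one, so that its coefficients
    are the minors in the equations of the theorem. *)
Definition triple u v w : F :=
  (u 0 I2 * v 0 I3 - u 0 I3 * v 0 I2) * w 0 I1 +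
  (u 0 I3 * v 0 I1 - u 0 I1 * v 0 I3) * w 0 I2 +
  (u 0 I1 * v 0 I2 - u 0 I2 * v 0 I1) * w 0 I3.

Lemma det_triple (A : 'M[F]_3) :
  \det A = triple (row I1 A) (row I2 A) (row I3 A).
Proof.
(* Indices become natural numbers, so that the lifted ordinals left by the expansions reduce to the
   same entries for [ring]. *)
pose a m n := A (inord m) (inord n).
have aE i j : A i j = a i j by rewrite /a !inord_val.
rewrite (expand_det_row _ I3) sum3 /cofactor.
rewrite !(expand_det_row _ ord0) !big_ord_recl !big_ord0 /cofactor !det_mx11.
rewrite !mxE /triple !mxE !aE /= /bump /=; ring.
Qed.

Lemma row3P u v : u 0 I1 = v 0 I1 -> u 0 I2 = v 0 I2 -> u 0 I3 = v 0 I3 ->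
  u = v.
Proof. by move=> *; apply/rowP => i; case: (ord3P i) => ->. Qed.

(** Cramer's rule without division, a polynomial identity in the entries. *)
Lemma triple_cramer u v w x : triple u v w *: x =
  triple v w x *: u + triple w u x *: v + triple u v x *: w.
Proof. by apply: row3P; rewrite !mxE /triple; ring. Qed.

(** Cramer's rule by components. For [s] the curl of a form, the three scalars are values of its
    exterior derivative. *)
Lemma triple_dual u v w s : triple u v w *: s =
  \row_k (triple u v s * w 0 k + triple v w s * u 0 k + triple w u s * v 0 k).
Proof. by apply: row3P; rewrite !mxE /triple; ring. Qed.
End TripleProduct.

(** * Exterior derivatives and brackets in coordinates *)

Section FormCalculus.
Context {R : realType} {M : oriented_manifold3 R} (c : chart R M).
Implicit Types (X Y eta : M -> 'rV[R]_3) (f : M -> R) (p : M).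

Definition dcoef eta (i j : 'I_3) p : R :=
  2^-1 * (pd c i (fun q => eta q 0 j) p - pd c j (fun q => eta q 0 i) p).

(** The vector that represents d(eta) through the coordinate determinant; the factor in [dcoef]
    makes it half the classical curl. *)
Definition curl eta p : 'rV[R]_3 := \row_k
  tnth [tuple dcoef eta I2 I3 p; dcoef eta I3 I1 p; dcoef eta I1 I2 p] k.

(** The derivatives of [X] and [Y] produced by the Leibniz rule cancel against those in the bracket,
    so the fields matter only through [X p] and [Y p]. *)
Lemma dformE eta X Y p :
  smooth_row c eta -> smooth_row c X -> smooth_row c Y -> dom c p ->
  dform c eta X Y p = triple (X p) (Y p) (curl eta p).
Proof.
move=> etas Xs Ys cp.
have pdE Z i : smooth_row c Z -> pd c i (pair_form eta Z) p =
    \sum_k (eta p 0 k * pd c i (fun q => Z q 0 k) p +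
      Z p 0 k * pd c i (fun q => eta q 0 k) p).
  move=> Zs.
  have -> := pd_sum i (fun k => smoothM (etas k) (Zs k)) cp.
  apply: eq_bigr => k _.
  exact: pdM (smooth_regular (etas k)) (smooth_regular (Zs k)) cp.
have dirE Z V : smooth_row c V -> dir c Z (pair_form eta V) p =
    \sum_i Z p 0 i * \sum_k (eta p 0 k * pd c i (fun q => V q 0 k) p +
      V p 0 k * pd c i (fun q => eta q 0 k) p).
  by move=> Vs; apply: eq_bigr => i _; rewrite (pdE _ _ Vs).
rewrite /dform (dirE X Y Ys) (dirE Y X Xs) /pair_form /triple !sum3 !mxE.
rewrite !(tnth_nth 0) /= /dcoef /dir !sum3.
pose dX i j := pd c i (fun q => X q 0 j) p.
pose dY i j := pd c i (fun q => Y q 0 j) p.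
pose de i j := pd c i (fun q => eta q 0 j) p.
rewrite -!/(dX _ _) -!/(dY _ _) -!/(de _ _).
by move: dX dY de => dX dY de; ring.
Qed.

(** This is d(d(eta)) = 0: the mixed second derivatives cancel in pairs by [pd_comm]. *)
Lemma closed_dform eta p : smooth_row c eta -> dom c p ->
  pd c I1 (fun q => curl eta q 0 I1) p +
  pd c I2 (fun q => curl eta q 0 I2) p +
  pd c I3 (fun q => curl eta q 0 I3) p = 0.
Proof.
move=> etas cp.
have pdE i j k : pd c i (dcoef eta j k) p = 2^-1 *
    (pd c i (pd c j (fun q => eta q 0 k)) p -
     pd c i (pd c k (fun q => eta q 0 j)) p).
  by rewrite pdZ ?pdB //; [exact: smooth_pd|exact: smooth_pd|
    apply: smoothB; exact: smooth_pd].
have cE i j k l : (forall q, curl eta q 0 i = dcoef eta j k q) ->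
    pd c l (fun q => curl eta q 0 i) p = pd c l (dcoef eta j k) p.
  by move=> E; apply: pd_congr => // q _; exact: E.
rewrite (cE I1 I2 I3) ?(cE I2 I3 I1) ?(cE I3 I1 I2) => [|q|q|q];
  rewrite ?mxE ?(tnth_nth 0) //.
rewrite !pdE (pd_comm I2 I1 (etas I3) cp) (pd_comm I3 I1 (etas I2) cp).
rewrite (pd_comm I3 I2 (etas I1) cp).
by move: (pd _ _ _ _) (pd _ _ _ _) (pd _ _ _ _) => x y z; ring.
Qed.

Lemma dir_cst X f (k : R) p : (forall q, dom c q -> f q = k) -> dom c p ->
  dir c X f p = 0.
Proof.
move=> fk cp; apply: big1 => i _.
by rewrite (@pd_congr _ _ c i f (cst k)) // pd_cst mulr0.
Qed.

Lemma dform_cst eta X Y (k l : R) p :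
  (forall q, dom c q -> pair_form eta X q = k) ->
  (forall q, dom c q -> pair_form eta Y q = l) -> dom c p ->
  dform c eta X Y p = - (2^-1 * pair_form eta (bracket c X Y) p).
Proof.
move=> Xk Yl cp.
by rewrite /dform (dir_cst _ Yl) // (dir_cst _ Xk) // subrr sub0r mulrN.
Qed.

Lemma bracket_congr X X' Y Y' p :
  (forall q, dom c q -> X q = X' q) -> (forall q, dom c q -> Y q = Y' q) ->
  dom c p -> bracket c X Y p = bracket c X' Y' p.
Proof.
move=> XX YY cp; apply/rowP => j; rewrite !mxE; congr (_ - _).
  apply: eq_bigr => i _; rewrite XX //; congr (_ * _).
  by apply: pd_congr => // q cq; rewrite YY.
apply: eq_bigr => i _; rewrite YY //; congr (_ * _).
by apply: pd_congr => // q cq; rewrite XX.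
Qed.

Lemma bracketNr X Y p : smooth_row c Y -> dom c p ->
  bracket c X (fun q => - Y q) p = - bracket c X Y p.
Proof.
move=> Ys cp; apply/rowP => j; rewrite !mxE /dir opprB addrC -!sumrN.
congr (_ + _); apply: eq_bigr => i _.
  by rewrite !mxE mulNr opprK.
rewrite -mulrN -pdN //; congr (_ * _).
by apply: pd_congr => // q _; rewrite mxE.
Qed.

End FormCalculus.

(** * Components of a vector in an orthonormal frame *)

Section OrthonormalFrame.
Context {F : fieldType} (G : 'M[F]_3).
Implicit Types x y z : 'rV[F]_3.

Definition ip x y : F := (x *m G *m y^T) 0 0.

Lemma ipDl x y z : ip (x + y) z = ip x z + ip y z.
Proof. by rewrite /ip !mulmxDl mxE. Qed.

Lemma ipZl k x z : ip (k *: x) z = k * ip x z.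
Proof. by rewrite /ip -!scalemxAl mxE. Qed.

Lemma ipDr x y z : ip z (x + y) = ip z x + ip z y.
Proof. by rewrite /ip linearD mulmxDr mxE. Qed.

Lemma ipZr k x z : ip z (k *: x) = k * ip z x.
Proof. by rewrite /ip linearZ -scalemxAr mxE. Qed.

Lemma ipNl x z : ip (- x) z = - ip x z.
Proof. by rewrite -scaleN1r ipZl mulN1r. Qed.

Lemma ipNr x z : ip z (- x) = - ip z x.
Proof. by rewrite -scaleN1r ipZr mulN1r. Qed.

Variable e : 'I_3 -> 'rV[F]_3.
Hypothesis orth : forall i j, ip (e i) (e j) = (i == j)%:R.

Let D := triple (e I1) (e I2) (e I3).

(** Cramer's rule paired with the frame. It turns each triple product of the equations into [D]
    times a component of a bracket. *)
Lemma ip_triple x :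
  [/\ D * ip x (e I1) = triple (e I2) (e I3) x,
      D * ip x (e I2) = triple (e I3) (e I1) x &
      D * ip x (e I3) = triple (e I1) (e I2) x].
Proof.
by split; rewrite -ipZl (triple_cramer (e I1) (e I2)) !(ipDl, ipZl) !orth
  ?mulr0 ?mulr1 ?addr0 ?add0r.
Qed.

Lemma ip_expand x : D != 0 ->
  x = ip x (e I1) *: e I1 + ip x (e I2) *: e I2 + ip x (e I3) *: e I3.
Proof.
move=> D0; have [x1 x2 x3] := ip_triple x.
apply: (scalerI D0); rewrite !scalerDr !scalerA x1 x2 x3.
exact: triple_cramer.
Qed.

End OrthonormalFrame.

(** * Derivatives of triple products and the trace identity *)

Section FrameCalculus.
Context {R : realType} {M : oriented_manifold3 R} (c : chart R M).
Implicit Types (X Y u v w eta : M -> 'rV[R]_3) (f : M -> R) (p : M).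

Lemma smooth_triple u v w :
  smooth_row c u -> smooth_row c v -> smooth_row c w ->
  smooth c (dom c) (fun q => triple (u q) (v q) (w q)).
Proof.
move=> us vs ws.
have m i j l := smoothM (smoothB (smoothM (us i) (vs j))
  (smoothM (us j) (vs i))) (ws l).
exact: smoothD (smoothD (m I2 I3 I1) (m I3 I1 I2)) (m I1 I2 I3).
Qed.

Definition pd_row k X p : 'rV[R]_3 := \row_j pd c k (fun q => X q 0 j) p.

Lemma bracketE X Y p j : bracket c X Y p 0 j =
  \sum_i X p 0 i * pd_row i Y p 0 j - \sum_i Y p 0 i * pd_row i X p 0 j.
Proof.
by rewrite mxE; congr (_ - _); apply: eq_bigr => i _; rewrite mxE.
Qed.

Lemma pd_triple k u v w p :
  smooth_row c u -> smooth_row c v -> smooth_row c w -> dom c p ->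
  pd c k (fun q => triple (u q) (v q) (w q)) p =
  triple (pd_row k u p) (v p) (w p) + triple (u p) (pd_row k v p) (w p) +
  triple (u p) (v p) (pd_row k w p).
Proof.
move=> us vs ws cp.
have minorE (i j l : 'I_3) :
    smooth c (dom c) (fun q =>
      (u q 0 i * v q 0 j - u q 0 j * v q 0 i) * w q 0 l) /\
    pd c k (fun q => (u q 0 i * v q 0 j - u q 0 j * v q 0 i) * w q 0 l) p =
    (u p 0 i * v p 0 j - u p 0 j * v p 0 i) * pd_row k w p 0 l + w p 0 l *
    (u p 0 i * pd_row k v p 0 j + v p 0 j * pd_row k u p 0 i -
     (u p 0 j * pd_row k v p 0 i + v p 0 i * pd_row k u p 0 j)).
  have s1 := smoothM (us i) (vs j); have s2 := smoothM (us j) (vs i).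
  have s3 := smoothB s1 s2; have s4 := smoothM s3 (ws l).
  split; first exact s4.
  rewrite (pdM k (smooth_regular s3) (smooth_regular (ws l)) cp).
  rewrite (pdB k s1 s2 cp).
  rewrite (pdM k (smooth_regular (us i)) (smooth_regular (vs j)) cp).
  by rewrite (pdM k (smooth_regular (us j)) (smooth_regular (vs i)) cp) !mxE.
have [s1 E1] := minorE I2 I3 I1; have [s2 E2] := minorE I3 I1 I2.
have [s3 E3] := minorE I1 I2 I3.
have -> := pdD k (smooth_regular (smoothD s1 s2)) (smooth_regular s3) cp.
rewrite (pdD k (smooth_regular s1) (smooth_regular s2) cp) E1 E2 E3 /triple.
by move: (pd_row k u p) (pd_row k v p) (pd_row k w p) => du dv dw; ring.
Qed.

(* Both sides are the trace of [ad w] times the determinant of the frame; on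
   the right it is computed from the derivative of that determinant. *)
Lemma triple_bracket_divergence u v w p :
  smooth_row c u -> smooth_row c v -> smooth_row c w -> dom c p ->
  triple (v p) (w p) (bracket c w u p) + triple (w p) (u p) (bracket c w v p) =
  \sum_k (w p 0 k * pd c k (fun q => triple (u q) (v q) (w q)) p) -
  triple (u p) (v p) (w p) * \sum_k pd c k (fun q => w q 0 k) p.
Proof.
move=> us vs ws cp.
rewrite (eq_bigr _
  (fun k _ => congr1 ( *%R (w p 0 k)) (pd_triple k us vs ws cp))).
have -> : \sum_k pd c k (fun q => w q 0 k) p = \sum_k pd_row k w p 0 k.
  by apply: eq_bigr => k _; rewrite mxE.
rewrite !sum3 /triple !bracketE !sum3.
move: (pd_row I1 u p) (pd_row I2 u p) (pd_row I3 u p) => u1 u2 u3.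
move: (pd_row I1 v p) (pd_row I2 v p) (pd_row I3 v p) => v1 v2 v3.
by move: (pd_row I1 w p) (pd_row I2 w p) (pd_row I3 w p) => w1 w2 w3; ring.
Qed.

Section AdaptedFrame.
Variables u v w eta : M -> 'rV[R]_3.
Hypotheses (us : smooth_row c u) (vs : smooth_row c v) (ws : smooth_row c w).
Hypothesis etas : smooth_row c eta.
Hypothesis duv : forall p, dom c p -> dform c eta u v p = -1.
Hypothesis dwu : forall p, dom c p -> dform c eta w u p = 0.
Hypothesis dwv : forall p, dom c p -> dform c eta w v p = 0.

(** The hypotheses give d(eta) on all pairs of frame fields, so Cramer's rule determines the curl,
    and only its [w] component survives. *)
Lemma triple_curl k p : dom c p ->
  triple (u p) (v p) (w p) * curl c eta p 0 k = - w p 0 k.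
Proof.
move=> cp; move: (duv cp) (dwu cp) (dwv cp).
rewrite !dformE // => E1 E2 E3.
have := congr1 (fun x : 'rV__ => x 0 k)
  (triple_dual (u p) (v p) (w p) (curl c eta p)).
rewrite !mxE => ->; rewrite E1 E2.
have -> : triple (v p) (w p) (curl c eta p) = 0.
  by rewrite -[RHS]oppr0 -E3 /triple; ring.
ring.
Qed.

(* The vector field [curl eta = - w / triple u v w] is divergence-free. *)
Lemma triple_bracket_trace p : dom c p ->
  triple (v p) (w p) (bracket c w u p) +
  triple (w p) (u p) (bracket c w v p) = 0.
Proof.
move=> cp; rewrite triple_bracket_divergence //.
pose D q := triple (u q) (v q) (w q).
have curls k : smooth c (dom c) (fun q => curl c eta q 0 k).
  have dcs i j : smooth c (dom c) (dcoef c eta i j).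
    have pds (k' l : 'I_3) := smooth_pd k' (etas l).
    exact: smoothM (@smooth_cst _ _ c 2^-1) (smoothB (pds i j) (pds j i)).
  have cE i j k' : (forall q, dcoef c eta i j q = curl c eta q 0 k') ->
      smooth c (dom c) (fun q => curl c eta q 0 k').
    by move=> E; exact (smooth_congr (fun q _ => E q) (dcs i j)).
  by case: (ord3P k) => ->;
    [apply: (cE I2 I3)|apply: (cE I3 I1)|apply: (cE I1 I2)] => q;
    rewrite mxE (tnth_nth 0).
(* [triple_curl] holds on all of [dom c], so it may be differentiated. *)
have dE k : D p * pd c k (fun q => curl c eta q 0 k) p +
    curl c eta p 0 k * pd c k D p = - pd c k (fun q => w q 0 k) p.
  have Ds : smooth c (dom c) D by exact: smooth_triple.
  rewrite -(pdM k (smooth_regular Ds) (smooth_regular (curls k)) cp).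
  rewrite -(pdN k (ws k) cp); apply: pd_congr => // q cq.
  exact: triple_curl.
have wE k : w p 0 k = - (D p * curl c eta p 0 k).
  by rewrite triple_curl // opprK.
have dwE k : pd c k (fun q => w q 0 k) p = - (D p * pd c k
    (fun q => curl c eta q 0 k) p + curl c eta p 0 k * pd c k D p).
  by rewrite dE opprK.
rewrite -/(D p) !sum3 !dwE !wE.
(* After the substitution for [w] the derivatives of [D] cancel, and what is left is [D ^ 2] times
   the divergence of the curl. *)
rewrite -[RHS](mulr0 (D p ^+ 2)) -(closed_dform etas cp).
move: (pd c I1 D p) (pd c I2 D p) (pd c I3 D p) (D p) => D1 D2 D3 D0.
move: (pd _ _ _ _) (pd _ _ _ _) (pd _ _ _ _) => x y z; ring.
Qed.

End AdaptedFrame.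
End FrameCalculus.

(** * Contact metric structures adapted to a frame *)

Section Eigenbasis.
Context {R : realType} {M : oriented_manifold3 R} (c : chart R M).
Context (g : riemannian_metric M) (e : 'I_3 -> M -> 'rV[R]_3).
Hypothesis es : forall a, smooth_row c (e a).
Hypothesis orth : orthonormal_frame c g e.

Let D p := triple (e I1 p) (e I2 p) (e I3 p).
Hypothesis D0 : forall p, dom c p -> D p != 0.

(** The five equations with their minors read as triple products. By [ip_triple] they say C_31^3 =
    0, C_32^3 = 0, C_12^3 = 2, C_31^1 = 0 and C_32^2 = 0. *)
Definition frame_eqs p : Prop :=
  [/\ triple (e I1 p) (e I2 p) (bracket c (e I3) (e I1) p) = 0,
      triple (e I1 p) (e I2 p) (bracket c (e I3) (e I2) p) = 0,
      triple (e I1 p) (e I2 p) (bracket c (e I1) (e I2) p) = 2 * D p,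
      triple (e I2 p) (e I3 p) (bracket c (e I3) (e I1) p) = 0 &
      triple (e I3 p) (e I1 p) (bracket c (e I3) (e I2) p) = 0].

Lemma orth_ip p : dom c p ->
  forall a b, ip (gmat g c p) (e a p) (e b p) = (a == b)%:R.
Proof. by move=> cp a b; exact: orth. Qed.

Lemma smooth_const_row (x : 'rV[R]_3) : smooth_row c (fun=> x).
Proof. by move=> i; exact: (@smooth_cst _ _ c (x 0 i)). Qed.

Section DualForm.
Variable eta : M -> 'rV[R]_3.
Hypothesis etaE : forall p X, dom c p ->
  pair_form eta X p = ip (gmat g c p) (X p) (e I3 p).

Lemma pair_form_frame p a : dom c p -> pair_form eta (e a) p = (a == I3)%:R.
Proof. by move=> cp; rewrite etaE // orth_ip. Qed.

(* The factor -2 comes from the normalization of [dform]. *)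
Lemma triple_dform_frame p a b : dom c p ->
  triple (e I1 p) (e I2 p) (bracket c (e a) (e b) p) =
  - 2 * D p * dform c eta (e a) (e b) p.
Proof.
move=> cp.
rewrite (dform_cst (fun q => @pair_form_frame q a)
  (fun q => @pair_form_frame q b) cp) etaE //.
have [_ _ <-] := ip_triple (orth_ip cp) (bracket c (e a) (e b) p).
by rewrite -/(D p); field; rewrite ?pnatr_eq0.
Qed.

End DualForm.

(** * From an eigenbasis to the equations *)

Section Necessity.
Variables (eta xi : M -> 'rV[R]_3) (phi : M -> 'M[R]_3).
Hypothesis cm : contact_metric c g eta xi phi.
Hypothesis eig : phi_eigenbasis c g xi phi e.

Lemma eigenbasis_frame_eqs p : dom c p -> frame_eqs p.
Proof.
move=> cp; have [_ e3 e2 [lam hE]] := eig.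
have etas := eta_smooth cm.
have etaE q X : dom c q -> pair_form eta X q = ip (gmat g c q) (X q) (e I3 q).
  move=> cq; rewrite e3 //.
  (* [eta_dual] speaks of smooth fields; freezing [X] at its value in [q] extends it to any field,
     such as a bracket. *)
  exact: (eta_dual cm (smooth_const_row (X q)) cq).
have tE a b q := @triple_dform_frame eta etaE q a b.
have dxi a q : dom c q -> dform c eta (e I3) (e a) q = 0.
  (* [dformE] reads the fields only at [q], so [e I3] can be exchanged for [xi], with which it is
     known to agree on [dom c]. *)
  move=> cq; rewrite (dformE etas (es I3) (es a) cq) e3 //.
  rewrite -(dformE etas (xi_smooth cm) (es a) cq).
  exact: deta_xi cm _ (es a) _ cq.
(* Here phi e_2 = phi (phi e_1) = - e_1, since eta(e_1) = 0. *)
have phi2 q : dom c q -> e I2 q *m phi q = - e I1 q.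
  move=> cq; rewrite e2 //; have := phi_sqr cm (es I1) cq.
  rewrite /app_endo => ->; rewrite (pair_form_frame etaE) //.
  by rewrite scale0r addr0.
have d12 q : dom c q -> dform c eta (e I1) (e I2) q = -1.
  move=> cq; rewrite (deta_metric cm (es I1) (es I2) cq).
  rewrite -[LHS]/(ip (gmat g c q) (e I1 q) (e I2 q *m phi q)).
  by rewrite phi2 // ipNr orth_ip.
have T31 : triple (e I1 p) (e I2 p) (bracket c (e I3) (e I1) p) = 0.
  by rewrite tE // dxi // mulr0.
have T32 : triple (e I1 p) (e I2 p) (bracket c (e I3) (e I2) p) = 0.
  by rewrite tE // dxi // mulr0.
have T12 : triple (e I1 p) (e I2 p) (bracket c (e I1) (e I2) p) = 2 * D p.
  by rewrite tE // d12 // mulrN1 mulNr opprK.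
have tr := triple_bracket_trace (es I1) (es I2) (es I3) etas d12
  (dxi I1) (dxi I2) cp.
set x := bracket c (e I3) (e I1) p in T31 tr *.
set y := bracket c (e I3) (e I2) p in T32 tr *.
have [x1 _ x3] := ip_triple (orth_ip cp) x.
have [_ y2 _] := ip_triple (orth_ip cp) y.
(* This is the e_2 component of h e_1 = lambda e_1: the term [xi, phi e_1] contributes C_32^2 and,
   as C_31^3 = 0, the term phi [xi, e_1] contributes C_31^1. *)
have hx : ip (gmat g c p) y (e I2 p) = ip (gmat g c p) x (e I1 p).
  have [h1 _] := hE p cp.
  have := congr1 (fun z => ip (gmat g c p) z (e I2 p)) h1.
  rewrite [RHS]ipZl orth_ip // mulr0 /h_field ipZl /lie_endo.
  have bxi X Y : (forall q, dom c q -> X q = Y q) ->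
      bracket c xi X p = bracket c (e I3) Y p.
    by move=> XY; apply: bracket_congr => // q cq; rewrite e3.
  rewrite (@bxi _ (e I2)) => [|q /e2 ->//].
  rewrite /app_endo (@bxi _ (e I1)) // -/x -/y.
  rewrite {1}(ip_expand (orth_ip cp) x (D0 cp)).
  have -> : ip (gmat g c p) x (e I3 p) = 0.
    by apply: (mulfI (D0 cp)); rewrite x3 T31 mulr0.
  rewrite scale0r addr0 mulmxDl -!scalemxAl phi2 // -[e I1 p *m _]e2 //.
  rewrite !(ipDl, ipNl, ipZl) !orth_ip //= mulr1 oppr0 mulr0 addr0.
  by move=> /eqP; rewrite mulf_eq0 invr_eq0 pnatr_eq0 /= subr_eq0 => /eqP.
have yx : triple (e I3 p) (e I1 p) y = triple (e I2 p) (e I3 p) x.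
  by rewrite -y2 -x1 hx.
(* The trace identity now says that twice this number is zero. *)
have x0 : triple (e I2 p) (e I3 p) x = 0.
  by move: tr; rewrite yx -mulr2n => /eqP; rewrite mulrn_eq0 => /eqP.
by split=> //; rewrite yx.
Qed.

End Necessity.

(** * From the equations to a contact metric structure *)

Section Sufficiency.
Hypothesis hc : atlas c.
Hypothesis eqs : forall p, dom c p -> frame_eqs p.

Let eta p : 'rV[R]_3 := (gmat g c p *m (e I3 p)^T)^T.

(** The quarter turn e_1 |-> e_2 |-> - e_1 that kills e_3; with [G] the matrix of g, the product
    [G e_1^T e_2] acts on rows as x |-> g(x, e_1) e_2. *)
Let phi p : 'M[R]_3 :=
  gmat g c p *m (e I1 p)^T *m e I2 p - gmat g c p *m (e I2 p)^T *m e I1 p.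

Let gip p := ip (gmat g c p).

Lemma dual_formE p X : pair_form eta X p = gip p (X p) (e I3 p).
Proof.
rewrite /gip /ip -mulmxA mxE; apply: eq_bigr => i _.
by rewrite mulrC [eta p 0 i]mxE.
Qed.

Lemma rotationE p (x : 'rV[R]_3) :
  x *m phi p = gip p x (e I1 p) *: e I2 p - gip p x (e I2 p) *: e I1 p.
Proof.
rewrite /phi mulmxBr !mulmxA /gip /ip.
by rewrite {1}[_ *m (e I1 p)^T]mx11_scalar {1}[_ *m (e I2 p)^T]mx11_scalar
  !mul_scalar_mx.
Qed.

Lemma smooth_lower a i :
  smooth c (dom c) (fun q => (gmat g c q *m (e a q)^T) i 0).
Proof.
have s := smooth_sum (fun k => smoothM (gmat_smooth g hc i k) (es a k)).
refine (smooth_congr _ s) => q _; rewrite mxE.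
by apply: eq_bigr => k _; rewrite [in RHS]mxE.
Qed.

Lemma smooth_dual_form : smooth_row c eta.
Proof.
by move=> i; refine (smooth_congr _ (smooth_lower I3 i)) => q _;
  rewrite [in RHS]mxE.
Qed.

Lemma smooth_rotation : smooth_endo c phi.
Proof.
move=> i j; refine (smooth_congr _ (smoothB
  (smoothM (smooth_lower I1 i) (es I2 j))
  (smoothM (smooth_lower I2 i) (es I1 j)))) => q _.
by rewrite [in RHS]mxE [in RHS]mxE; congr (_ + _);
  rewrite ?[in RHS]mxE ?[X in _ = - X]mxE big_ord1.
Qed.

Lemma dform_dual_frame p a b (k : R) : dom c p ->
  triple (e I1 p) (e I2 p) (bracket c (e a) (e b) p) = k * D p ->
  dform c eta (e a) (e b) p = - (2^-1 * k).
Proof.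
move=> cp; rewrite (triple_dform_frame (fun p X _ => dual_formE p X)) // => E.
have : (-2 * dform c eta (e a) (e b) p) * D p = k * D p by rewrite -E; ring.
by move/(mulIf (D0 cp)) => <-; field; rewrite ?pnatr_eq0.
Qed.

Lemma dform_dual12 p : dom c p -> dform c eta (e I1) (e I2) p = -1.
Proof.
move=> cp; have [_ _ E _ _] := eqs cp.
by rewrite (dform_dual_frame cp E) mulVf // pnatr_eq0.
Qed.

Lemma dform_dual31 p : dom c p -> dform c eta (e I3) (e I1) p = 0.
Proof.
move=> cp; have [E _ _ _ _] := eqs cp.
by rewrite (@dform_dual_frame p _ _ 0) // ?mulr0 ?oppr0 // mul0r.
Qed.

Lemma dform_dual32 p : dom c p -> dform c eta (e I3) (e I2) p = 0.
Proof.
move=> cp; have [_ E _ _ _] := eqs cp.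
by rewrite (@dform_dual_frame p _ _ 0) // ?mulr0 ?oppr0 // mul0r.
Qed.

(** By [triple_curl] the curl of [eta] is - e_3 / D, which gives d(eta) on all smooth fields and not
    only on the frame. *)
Lemma dform_dual p X Y : smooth_row c X -> smooth_row c Y -> dom c p ->
  D p * dform c eta X Y p = - triple (X p) (Y p) (e I3 p).
Proof.
move=> Xs Ys cp; rewrite (dformE smooth_dual_form Xs Ys cp).
have E k := triple_curl (es I1) (es I2) (es I3) smooth_dual_form
  dform_dual12 dform_dual31 dform_dual32 k cp.
move: (E I1) (E I2) (E I3); rewrite -/(D p) /triple => E1 E2 E3.
by rewrite !mulrDr !(mulrCA (D p)) E1 E2 E3; ring.
Qed.

Lemma contact_metric_dual : contact_metric c g eta (e I3) phi.
Proof.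
split.
- exact: smooth_dual_form.
- exact: es.
- exact: smooth_rotation.
(* The frame itself is a witness: the 3-form takes the value - 1/3 on it. *)
- move=> p cp; exists (e I1), (e I2), (e I3); split; try exact: es.
  rewrite /wedge_d !dual_formE /gip !orth_ip //= !mul0r !add0r mul1r.
  by rewrite dform_dual12 // mulrN1 oppr_eq0 invr_eq0 pnatr_eq0.
- by move=> p cp; rewrite dual_formE /gip orth_ip.
(* The triple product given by [dform_dual] contains e_3 twice, hence vanishes. *)
- move=> X Xs p cp; apply: (mulfI (D0 cp)).
  by rewrite (dform_dual (es I3) Xs cp) /triple; ring.
- move=> X Xs p cp; rewrite /app_endo dual_formE (rotationE p (X p)) mulmxBl.
  rewrite -!scalemxAl !rotationE /gip !orth_ip //= !scale0r !scale1r.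
  rewrite subr0 sub0r.
  rewrite {3}(ip_expand (orth_ip cp) (X p) (D0 cp)).
  by rewrite scalerN opprD subrK opprD.
- by move=> X Xs p cp; rewrite dual_formE.
- move=> X Y Xs Ys p cp; rewrite -[RHS]/(gip p (X p) (Y p *m phi p)).
  rewrite rotationE /gip ipDr ipNr !ipZr.
  have [x1 x2 _] := ip_triple (orth_ip cp) (X p).
  have [y1 y2 _] := ip_triple (orth_ip cp) (Y p).
  (* Multiplication by [D ^ 2] absorbs one [D] into each component of [X] and [Y], which leaves a
     polynomial identity between triple products. *)
  apply: (mulfI (D0 cp)); rewrite dform_dual //.
  apply: (mulfI (D0 cp)).
  rewrite -/(D p) in x1 x2 y1 y2.
  rewrite mulrA mulrBr.
  rewrite [X in _ = X - _]mulrACA [X in _ = _ - X]mulrACA x1 x2 y1 y2.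
  by rewrite /D /triple; ring.
Qed.

(** The equations leave [e_3, e_1] along e_2 and [e_3, e_2] along e_1, so h e_1 and h e_2 can be
    computed outright. *)
Lemma phi_eigenbasis_dual : phi_eigenbasis c g (e I3) phi e.
Proof.
have phi1 p : dom c p -> e I1 p *m phi p = e I2 p.
  by move=> cp; rewrite rotationE /gip !orth_ip //= scale1r scale0r subr0.
have phi2 p : dom c p -> e I2 p *m phi p = - e I1 p.
  by move=> cp; rewrite rotationE /gip !orth_ip //= scale1r scale0r sub0r.
split=> //.
  by move=> p cp; rewrite /app_endo phi1.
pose x p := bracket c (e I3) (e I1) p; pose y p := bracket c (e I3) (e I2) p.
(* If [e_3, e_1] = k e_2 and [e_3, e_2] = l e_1, then 2 h e_1 = [e_3, e_2] - phi [e_3, e_1] = (l +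
   k) e_1. *)
exists (fun p => 2^-1 * (gip p (y p) (e I1 p) + gip p (x p) (e I2 p))).
move=> p cp; have [E1 E2 _ E4 E5] := eqs cp.
have zero k t : D p * k = t -> t = 0 -> k = 0.
  by move=> Dk t0; apply: (mulfI (D0 cp)); rewrite Dk t0 mulr0.
have [x1 _ x3] := ip_triple (orth_ip cp) (x p).
have [_ y2 y3] := ip_triple (orth_ip cp) (y p).
have xE : x p = gip p (x p) (e I2 p) *: e I2 p.
  rewrite {1}(ip_expand (orth_ip cp) (x p) (D0 cp)).
  by rewrite (zero _ _ x1 E4) (zero _ _ x3 E1) !scale0r add0r addr0.
have yE : y p = gip p (y p) (e I1 p) *: e I1 p.
  rewrite {1}(ip_expand (orth_ip cp) (y p) (D0 cp)).
  by rewrite (zero _ _ y2 E5) (zero _ _ y3 E2) !scale0r !addr0.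
have xphi : x p *m phi p = - (gip p (x p) (e I2 p) *: e I1 p).
  by rewrite {1}xE -scalemxAl phi2 // scalerN.
have yphi : y p *m phi p = gip p (y p) (e I1 p) *: e I2 p.
  by rewrite {1}yE -scalemxAl phi1.
have b1 : bracket c (e I3) (app_endo phi (e I1)) p = y p.
  by apply: bracket_congr => // q cq; rewrite /app_endo phi1.
have b2 : bracket c (e I3) (app_endo phi (e I2)) p = - x p.
  rewrite -(bracketNr _ (es I1) cp).
  by apply: bracket_congr => // q cq; rewrite /app_endo phi2.
rewrite /h_field /lie_endo b1 b2 /app_endo -/(x p) -/(y p).
rewrite xphi yphi.
move: (gip p (x p) _) (gip p (y p) _) xE yE => k l -> ->.
by split; apply/rowP => i; rewrite !mxE; ring.
Qed.

End Sufficiency.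
End Eigenbasis.

(** * The equations in terms of the components [b] *)

Section FrameComponents.
Context {R : realType} {M : oriented_manifold3 R} (c : chart R M).
Variable b : 'I_3 -> 'I_3 -> M -> R.

Lemma frame_component a i : (fun q => frame b a q 0 i) = b a i.
Proof. by apply/funext => q; rewrite mxE. Qed.

Lemma bracket_frame a1 a2 j p :
  bracket c (frame b a1) (frame b a2) p 0 j =
  \sum_i (b a1 i p * pd c i (b a2 j) p - b a2 i p * pd c i (b a1 j) p).
Proof.
rewrite mxE /dir !frame_component sumrB; congr (_ - _);
  by apply: eq_bigr => i _; rewrite mxE.
Qed.

Lemma triple_bracket_frame a1 a2 a3 a4 p :
  triple (frame b a1 p) (frame b a2 p)
    (bracket c (frame b a3) (frame b a4) p) =
  (b a1 I2 p * b a2 I3 p - b a1 I3 p * b a2 I2 p)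
    * (\sum_i (b a3 i p * pd c i (b a4 I1) p - b a4 i p * pd c i (b a3 I1) p))
  + (b a1 I3 p * b a2 I1 p - b a1 I1 p * b a2 I3 p)
    * (\sum_i (b a3 i p * pd c i (b a4 I2) p - b a4 i p * pd c i (b a3 I2) p))
  + (b a1 I1 p * b a2 I2 p - b a1 I2 p * b a2 I1 p)
    * (\sum_i (b a3 i p * pd c i (b a4 I3) p - b a4 i p * pd c i (b a3 I3) p)).
Proof.
have bE a i : frame b a p 0 i = b a i p by rewrite mxE.
by rewrite /triple !bracket_frame !bE.
Qed.

Lemma det_frame p : \det (\matrix_(a, i) b a i p) =
  triple (frame b I1 p) (frame b I2 p) (frame b I3 p).
Proof.
rewrite det_triple.
by congr (triple _ _ _); apply/rowP => i; rewrite !mxE.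
Qed.

End FrameComponents.

Unset Implicit Arguments.
Theorem theorem6 (R : realType) (M : oriented_manifold3 R)
    (g : riemannian_metric M) (c : chart R M) (hc : atlas c)
    (b : 'I_3 -> 'I_3 -> M -> R)
    (b_smooth : forall a i, smooth c (dom c) (b a i))
    (b_orthonormal : orthonormal_frame c g (frame b))
    (b_positive : forall p, dom c p -> 0 < \det (\matrix_(a, i) b a i p)) :
  (exists (eta xi : M -> 'rV[R]_3) (phi : M -> 'M[R]_3),
      contact_metric c g eta xi phi /\
      phi_eigenbasis c g xi phi (frame b))
  <->
  (forall p, dom c p ->
    [/\ (b I1 I2 p * b I2 I3 p - b I1 I3 p * b I2 I2 p)
          * (\sum_i (b I3 i p * pd c i (b I1 I1) p
                  - b I1 i p * pd c i (b I3 I1) p))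
        + (b I1 I3 p * b I2 I1 p - b I1 I1 p * b I2 I3 p)
          * (\sum_i (b I3 i p * pd c i (b I1 I2) p
                  - b I1 i p * pd c i (b I3 I2) p))
        + (b I1 I1 p * b I2 I2 p - b I1 I2 p * b I2 I1 p)
          * (\sum_i (b I3 i p * pd c i (b I1 I3) p
                  - b I1 i p * pd c i (b I3 I3) p))
        = 0,
        (b I1 I2 p * b I2 I3 p - b I1 I3 p * b I2 I2 p)
          * (\sum_i (b I3 i p * pd c i (b I2 I1) p
                  - b I2 i p * pd c i (b I3 I1) p))
        + (b I1 I3 p * b I2 I1 p - b I1 I1 p * b I2 I3 p)
          * (\sum_i (b I3 i p * pd c i (b I2 I2) p
                  - b I2 i p * pd c i (b I3 I2) p))
        + (b I1 I1 p * b I2 I2 p - b I1 I2 p * b I2 I1 p)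
          * (\sum_i (b I3 i p * pd c i (b I2 I3) p
                  - b I2 i p * pd c i (b I3 I3) p))
        = 0,
        (b I1 I2 p * b I2 I3 p - b I1 I3 p * b I2 I2 p)
          * (\sum_i (b I1 i p * pd c i (b I2 I1) p
                  - b I2 i p * pd c i (b I1 I1) p))
        + (b I1 I3 p * b I2 I1 p - b I1 I1 p * b I2 I3 p)
          * (\sum_i (b I1 i p * pd c i (b I2 I2) p
                  - b I2 i p * pd c i (b I1 I2) p))
        + (b I1 I1 p * b I2 I2 p - b I1 I2 p * b I2 I1 p)
          * (\sum_i (b I1 i p * pd c i (b I2 I3) p
                  - b I2 i p * pd c i (b I1 I3) p))
        = 2 * \det (\matrix_(a, i) b a i p),
        (b I2 I2 p * b I3 I3 p - b I2 I3 p * b I3 I2 p)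
          * (\sum_i (b I3 i p * pd c i (b I1 I1) p
                  - b I1 i p * pd c i (b I3 I1) p))
        + (b I2 I3 p * b I3 I1 p - b I2 I1 p * b I3 I3 p)
          * (\sum_i (b I3 i p * pd c i (b I1 I2) p
                  - b I1 i p * pd c i (b I3 I2) p))
        + (b I2 I1 p * b I3 I2 p - b I2 I2 p * b I3 I1 p)
          * (\sum_i (b I3 i p * pd c i (b I1 I3) p
                  - b I1 i p * pd c i (b I3 I3) p))
        = 0 &
        (b I1 I3 p * b I3 I2 p - b I1 I2 p * b I3 I3 p)
          * (\sum_i (b I3 i p * pd c i (b I2 I1) p
                  - b I2 i p * pd c i (b I3 I1) p))
        + (b I1 I1 p * b I3 I3 p - b I1 I3 p * b I3 I1 p)
          * (\sum_i (b I3 i p * pd c i (b I2 I2) p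
                  - b I2 i p * pd c i (b I3 I2) p))
        + (b I1 I2 p * b I3 I1 p - b I1 I1 p * b I3 I2 p)
          * (\sum_i (b I3 i p * pd c i (b I2 I3) p
                  - b I2 i p * pd c i (b I3 I3) p))
        = 0
    ]).
Proof.
have es a : smooth_row c (frame b a).
  by move=> i; rewrite frame_component; exact: b_smooth.
have D0 p : dom c p ->
    triple (frame b I1 p) (frame b I2 p) (frame b I3 p) != 0.
  by move=> cp; rewrite -det_frame lt0r_neq0 // b_positive.
(* The fifth equation has the factors of its minors in another order than [triple] produces; the
   three equalities serve as one rewrite rule. *)
have commuted p : (b I1 I3 p * b I3 I2 p - b I1 I2 p * b I3 I3 p =
      b I3 I2 p * b I1 I3 p - b I3 I3 p * b I1 I2 p) *
    (b I1 I1 p * b I3 I3 p - b I1 I3 p * b I3 I1 p =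
      b I3 I3 p * b I1 I1 p - b I3 I1 p * b I1 I3 p) *
    (b I1 I2 p * b I3 I1 p - b I1 I1 p * b I3 I2 p =
      b I3 I1 p * b I1 I2 p - b I3 I2 p * b I1 I1 p).
  by split; [split|]; congr (_ - _); exact: mulrC.
suff main : (exists (eta xi : M -> 'rV[R]_3) (phi : M -> 'M[R]_3),
      contact_metric c g eta xi phi /\ phi_eigenbasis c g xi phi (frame b)) <->
    (forall p, dom c p -> frame_eqs c (frame b) p).
  rewrite main; split=> eqs p /eqs []; rewrite !commuted det_frame;
    rewrite -!triple_bracket_frame => *; split=> //.
split=> [[eta [xi [phi [cm eig]]]] p cp|eqs].
  exact: (eigenbasis_frame_eqs es b_orthonormal D0 cm eig cp).
(* The witnesses, found by unification, are the metric dual of e_3, the field e_3 and the quarter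
   turn. *)
eexists _, _, _; split.
  exact: (contact_metric_dual es b_orthonormal D0 hc eqs).
exact: (phi_eigenbasis_dual es b_orthonormal D0 eqs).
Qed.
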